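(* Let $\beta: I\to M\subset G^3$ be a unit-speed curve on a surface $M$ in the Galilean space $G^3$, with normal curvature $\kappa_n$, which is a geodesic ($\kappa_g\equiv0$) and an anti-Salkowski curve (its torsion $\tau$ is constant and its curvature $\kappa$ is not constant). Then there are real constants $b,b_1,b_2,b_3$ such that, for a suitable choice of antiderivatives, $$\beta(x)=\Bigg(x,\ \int\!\!\int\kappa_n(x)\big[\cos(bx+b_1)+b_2\big]dx\,dx,\ -\int\!\!\int\kappa_n(x)\big[\sin(bx+b_1)+b_3\big]dx\,dx\Bigg).$$
   Context: The Galilean space $G^3$ is $\mathbb R^3$ with the scalar product $\mathbf v\cdot_G\mathbf w=v_1w_1$ if $v_1\ne0$ or $w_1\neq 0$, and $\mathbf v\cdot_G\mathbf w=v_2w_2+v_3w_3$ if $v_1=w_1=0$; the norm is $\|\mathbf v\|_G=\sqrt{|\mathbf v\cdot_G\mathbf v|}$ and the cross product is $\mathbf v\times_G\mathbf w=(0,\,v_3w_1-v_1w_3,\,v_1w_2-v_2w_1)$. A vector is isotropic if its first component is $0$. All objects are smooth and $I\subset\mathbb R$ is an open interval. $M$ is an oriented surface with local parametrizations $\phi(u,v)$ such that the first components of $\phi_u,\phi_v$ are not both zero; its unit normal is the isotropic vector field $\mathbf n=\pm\,\phi_u\times_G\phi_v/\|\phi_u\times_G\phi_v\|_G$ (sign fixed by the orientation). A unit-speed curve (parametrized by arc length) is one of the form $\beta(x)=(x,y(x),z(x))$, $x\in I$. Its curvature is $\kappa=\|\beta''\|_G$, assumed positive, and its torsion is $\tau=\det(\beta',\beta'',\beta''')/\kappa^2$.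 Its Darboux frame with respect to $M$ is $\{\mathbf T,\mathbf Q,\mathbf n\}$ with $\mathbf T=\beta'$, $\mathbf n$ the unit normal of $M$ along $\beta$, and $\mathbf Q=\mathbf T\times_G\mathbf n$. The functions $\kappa_g=\mathbf T'\cdot_G\mathbf Q$, $\kappa_n=\mathbf T'\cdot_G\mathbf n$, $\tau_g=\mathbf Q'\cdot_G\mathbf n$ are the geodesic curvature, normal curvature and geodesic torsion. The symbol $\int g(x)\,dx$ denotes an antiderivative of $g$ on $I$. *)

(* Defs.v *)
From Stdlib Require Import Reals.
From Coquelicot Require Import Coquelicot.
Open Scope R_scope.

Definition R3 : Type := (R * R * R)%type.
Definition R2 : Type := (R * R)%type.

Definition c1 (p : R3) : R := fst (fst p).
Definition c2 (p : R3) : R := snd (fst p).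
Definition c3 (p : R3) : R := snd p.

Definition gdot (v w : R3) : R :=
  if Req_EM_T (c1 v) 0 then
    if Req_EM_T (c1 w) 0 then c2 v * c2 w + c3 v * c3 w else c1 v * c1 w
  else c1 v * c1 w.

Definition gnorm (v : R3) : R := sqrt (Rabs (gdot v v)).

Definition gcross (v w : R3) : R3 :=
  (0, c3 v * c1 w - c1 v * c3 w, c1 v * c2 w - c2 v * c1 w).

Definition scale3 (k : R) (v : R3) : R3 := (k * c1 v, k * c2 v, k * c3 v).

Definition det3 (u v w : R3) : R :=
    c1 u * (c2 v * c3 w - c3 v * c2 w)
  - c2 u * (c1 v * c3 w - c3 v * c1 w)
  + c3 u * (c1 v * c2 w - c2 v * c1 w).

(** [ex_diff_n f n] asks that all partial derivatives of [f] up to order [n]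
    exist and are continuous. *)
Definition smooth2_on (U : R2 -> Prop) (f : R2 -> R) : Prop :=
  forall (n : nat) (u v : R), U (u, v) -> ex_diff_n (fun s t => f (s, t)) n u v.

Definition partial_u (phi : R2 -> R3) (q : R2) : R3 :=
  (Derive (fun s => c1 (phi (s, snd q))) (fst q),
   Derive (fun s => c2 (phi (s, snd q))) (fst q),
   Derive (fun s => c3 (phi (s, snd q))) (fst q)).

Definition partial_v (phi : R2 -> R3) (q : R2) : R3 :=
  (Derive (fun t => c1 (phi (fst q, t))) (snd q),
   Derive (fun t => c2 (phi (fst q, t))) (snd q),
   Derive (fun t => c3 (phi (fst q, t))) (snd q)).

Definition lin_indep (v w : R3) : Prop :=
  forall a b : R,
    (a * c1 v + b * c1 w, a * c2 v + b * c2 w, a * c3 v + b * c3 w) = (0, 0, 0) ->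
    a = 0 /\ b = 0.

(** [phi] is a homeomorphism from [U] onto the relatively open subset
    [M /\ V] of [M]; continuity of [phi] itself is part of smoothness. *)
Definition homeo_onto_open (M : R3 -> Prop) (U : R2 -> Prop) (phi : R2 -> R3) : Prop :=
  exists (V : R3 -> Prop) (psi : R3 -> R2),
    open V /\
    (forall q, U q -> M (phi q) /\ V (phi q) /\ psi (phi q) = q) /\
    (forall p, M p -> V p ->
       U (psi p) /\ phi (psi p) = p /\
       filterlim psi (within M (locally p)) (locally (psi p))).

(** Regular local parametrization whose tangent planes are not isotropic. *)
Definition is_parametrization (M : R3 -> Prop) (U : R2 -> Prop) (phi : R2 -> R3) : Prop :=
  open U /\
  (smooth2_on U (fun q => c1 (phi q)) /\
   smooth2_on U (fun q => c2 (phi q)) /\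
   smooth2_on U (fun q => c3 (phi q))) /\
  homeo_onto_open M U phi /\
  (forall q, U q -> lin_indep (partial_u phi q) (partial_v phi q)) /\
  (forall q, U q -> c1 (partial_u phi q) <> 0 \/ c1 (partial_v phi q) <> 0).

Definition chart_normal (phi : R2 -> R3) (q : R2) : R3 :=
  let N := gcross (partial_u phi q) (partial_v phi q) in scale3 (/ gnorm N) N.

(** The orientation is recorded by the unit normal it induces: around each
    point there is a parametrization on whose whole domain the unit normal is
    [chart_normal] up to one constant sign [eps]. The values of [unit_normal]
    off the surface are irrelevant. *)
Record oriented_surface : Type := OrientedSurface {
  carrier : R3 -> Prop;
  unit_normal : R3 -> R3;
  surface_charts : forall p : R3, carrier p ->
    exists (U : R2 -> Prop) (phi : R2 -> R3) (eps : R),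
      is_parametrization carrier U phi /\
      (exists q, U q /\ phi q = p) /\
      (eps = 1 \/ eps = -1) /\
      (forall q, U q -> unit_normal (phi q) = scale3 eps (chart_normal phi q))
}.

Definition Rbar_open_interval (a b : Rbar) (x : R) : Prop := Rbar_lt a x /\ Rbar_lt x b.

Definition vderive (f : R -> R3) (x : R) : R3 :=
  (Derive (fun t => c1 (f t)) x,
   Derive (fun t => c2 (f t)) x,
   Derive (fun t => c3 (f t)) x).

Definition smooth_on (I : R -> Prop) (f : R -> R) : Prop :=
  forall (n : nat) (x : R), I x -> ex_derive_n f n x.

Definition unit_speed_curve (I : R -> Prop) (beta : R -> R3) : Prop :=
  (smooth_on I (fun x => c1 (beta x)) /\
   smooth_on I (fun x => c2 (beta x)) /\
   smooth_on I (fun x => c3 (beta x))) /\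
  (forall x, I x -> c1 (beta x) = x).

Definition curvature (beta : R -> R3) (x : R) : R :=
  gnorm (vderive (vderive beta) x).

Definition torsion (beta : R -> R3) (x : R) : R :=
  det3 (vderive beta x) (vderive (vderive beta) x)
       (vderive (vderive (vderive beta)) x) / (curvature beta x) ^ 2.

Definition darboux_T (beta : R -> R3) (x : R) : R3 := vderive beta x.

Definition darboux_n (M : oriented_surface) (beta : R -> R3) (x : R) : R3 :=
  unit_normal M (beta x).

Definition darboux_Q (M : oriented_surface) (beta : R -> R3) (x : R) : R3 :=
  gcross (darboux_T beta x) (darboux_n M beta x).

Definition geodesic_curvature (M : oriented_surface) (beta : R -> R3) (x : R) : R :=
  gdot (vderive (darboux_T beta) x) (darboux_Q M beta x).

Definition normal_curvature (M : oriented_surface) (beta : R -> R3) (x : R) : R :=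
  gdot (vderive (darboux_T beta) x) (darboux_n M beta x).

Definition is_geodesic (I : R -> Prop) (M : oriented_surface) (beta : R -> R3) : Prop :=
  forall x, I x -> geodesic_curvature M beta x = 0.

Definition constant_on (I : R -> Prop) (f : R -> R) : Prop :=
  exists c : R, forall x, I x -> f x = c.

Definition anti_salkowski (I : R -> Prop) (beta : R -> R3) : Prop :=
  constant_on I (torsion beta) /\ ~ constant_on I (curvature beta).

Definition antiderivative_on (I : R -> Prop) (F f : R -> R) : Prop :=
  forall x, I x -> is_derive F x (f x).

(** [F] is one of the values of the iterated indefinite integral of [f]. *)
Definition double_antiderivative_on (I : R -> Prop) (F f : R -> R) : Prop :=
  exists G : R -> R, antiderivative_on I G f /\ antiderivative_on I F G.

(* Main.v *)
From Stdlib Require Import Reals Lra.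
From Coquelicot Require Import Coquelicot.
Require Import Defs.
Open Scope R_scope.

(** The acceleration [(0, y'', z'')] of a unit-speed curve has norm [kappa], and its
    polar angle in the isotropic plane has derivative [tau]; for constant [tau] the angle
    is therefore affine. On a geodesic the acceleration is a multiple of the unit normal,
    so [kappa_n = kappa] or [kappa_n = - kappa] at each point, and since the unit normal
    is continuous along the curve the sign is constant. It is absorbed into the phase
    [b1], so that [b2 = b3 = 0]. *)

(** * Open intervals and functions that are constant on them *)

Lemma Rbar_open_interval_locally (a b : Rbar) (x : R) :
  Rbar_open_interval a b x -> locally x (Rbar_open_interval a b).
Proof.
  apply locally_open; [apply open_and|auto].
  - apply open_Rbar_gt.
  - apply open_Rbar_lt.
Qed.

Lemma Rbar_open_interval_convex (a b : Rbar) (x y t : R) :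
  Rbar_open_interval a b x -> Rbar_open_interval a b y -> x <= t <= y ->
  Rbar_open_interval a b t.
Proof.
  unfold Rbar_open_interval; destruct a, b; simpl; intuition lra.
Qed.

Lemma Rbar_open_interval_inhabited (a b : Rbar) :
  Rbar_lt a b -> exists x, Rbar_open_interval a b x.
Proof.
  unfold Rbar_open_interval; destruct a as [r| |], b as [s| |]; simpl; try tauto; intros H.
  - exists ((r + s) / 2); lra.
  - exists (r + 1); split; [lra|exact I].
  - exists (s - 1); split; [exact I|lra].
  - exists 0; auto.
Qed.

Lemma is_derive_zero_constant (a b : Rbar) (f : R -> R) :
  (forall x, Rbar_open_interval a b x -> is_derive f x 0) ->
  forall x y, Rbar_open_interval a b x -> Rbar_open_interval a b y -> f x = f y.
Proof.
  intros Hf.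
  assert (Hlt : forall x y, Rbar_open_interval a b x -> Rbar_open_interval a b y ->
                  x < y -> f x = f y).
  { intros x y Hx Hy Hxy.
    apply (eq_is_derive f x y); [|exact Hxy].
    intros t Ht; apply Hf, (Rbar_open_interval_convex a b x y t); assumption. }
  intros x y Hx Hy.
  destruct (Rtotal_order x y) as [H|[->|H]]; auto.
  symmetry; auto.
Qed.

(** The two values are at distance 2, so wherever [s] is within 1 of [s x] it equals [s x]. Thus [s]
    is locally constant and has derivative zero. *)
Lemma continuous_sign_constant (a b : Rbar) (s : R -> R) :
  (forall x, Rbar_open_interval a b x -> continuous s x) ->
  (forall x, Rbar_open_interval a b x -> s x = 1 \/ s x = -1) ->
  forall x y, Rbar_open_interval a b x -> Rbar_open_interval a b y -> s x = s y.
Proof.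
  intros Hc Hs; apply is_derive_zero_constant; intros x Hx.
  apply (is_derive_ext_loc (fun _ => s x)); [|apply (is_derive_const (s x))].
  assert (Hball : locally x (fun t => ball (s x) (mkposreal 1 Rlt_0_1) (s t))).
  { apply (proj1 (filterlim_locally s (s x)) (Hc x Hx)). }
  generalize (filter_and _ _ (Rbar_open_interval_locally a b x Hx) Hball).
  apply filter_imp; intros t [Ht Hb].
  change (Rabs (s t - s x) < 1) in Hb; apply Rabs_lt_between in Hb.
  destruct (Hs x Hx), (Hs t Ht); lra.
Qed.

(** * Unit vectors turning at constant angular velocity *)

Lemma unit_circle_angle (A B : R) :
  A ^ 2 + B ^ 2 = 1 -> exists t, A = cos t /\ B = sin t.
Proof.
  intros H.
  assert (HA : -1 <= A <= 1) by nra.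
  assert (Hs : sin (acos A) = Rabs B).
  { rewrite sin_acos by exact HA.
    replace (1 - A²) with (B²) by (unfold Rsqr; lra).
    apply sqrt_Rsqr_abs. }
  (* [acos A] has the right cosine and the sine [Rabs B]; the sign of [B] decides between it and its
     opposite. *)
  destruct (Rle_dec 0 B) as [HB|HB].
  - exists (acos A); rewrite cos_acos, Hs, Rabs_pos_eq by assumption; auto.
  - exists (- acos A); rewrite cos_neg, sin_neg, cos_acos, Hs, Rabs_left by lra; lra.
Qed.

(** Rotating [(c, s)] backwards by the angle [tau * x] makes it constant. *)
Lemma uniformly_rotating_unit_vector (a b : Rbar) (tau : R) (c s : R -> R) :
  Rbar_lt a b ->
  (forall x, Rbar_open_interval a b x -> is_derive c x (- tau * s x)) ->
  (forall x, Rbar_open_interval a b x -> is_derive s x (tau * c x)) ->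
  (forall x, Rbar_open_interval a b x -> c x ^ 2 + s x ^ 2 = 1) ->
  exists phi, forall x, Rbar_open_interval a b x ->
    c x = cos (tau * x + phi) /\ s x = sin (tau * x + phi).
Proof.
  intros Hab Hc Hs H1.
  destruct (Rbar_open_interval_inhabited a b Hab) as [x0 Hx0].
  set (A := fun x => c x * cos (tau * x) + s x * sin (tau * x)).
  set (B := fun x => s x * cos (tau * x) - c x * sin (tau * x)).
  assert (HA : forall x, Rbar_open_interval a b x -> A x = A x0).
  { intros x Hx; apply (is_derive_zero_constant a b); auto.
    intros t Ht; unfold A; specialize (Hc t Ht); specialize (Hs t Ht).
    auto_derive; [repeat split; eexists; eassumption|].
    replace (Derive (fun y => c y) t) with (- tau * s t) by (symmetry; exact (is_derive_unique c _ _ Hc)).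
    replace (Derive (fun y => s y) t) with (tau * c t) by (symmetry; exact (is_derive_unique s _ _ Hs)).
    ring. }
  assert (HB : forall x, Rbar_open_interval a b x -> B x = B x0).
  { intros x Hx; apply (is_derive_zero_constant a b); auto.
    intros t Ht; unfold B; specialize (Hc t Ht); specialize (Hs t Ht).
    auto_derive; [repeat split; eexists; eassumption|].
    replace (Derive (fun y => c y) t) with (- tau * s t) by (symmetry; exact (is_derive_unique c _ _ Hc)).
    replace (Derive (fun y => s y) t) with (tau * c t) by (symmetry; exact (is_derive_unique s _ _ Hs)).
    ring. }
  assert (Hcs : forall x, cos (tau * x) ^ 2 + sin (tau * x) ^ 2 = 1).
  { intros x; generalize (sin2_cos2 (tau * x)); unfold Rsqr; lra. }
  (* The phase is the polar angle of the constant vector [(A, B)], a unit vector because rotation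
     preserves the norm. *)
  destruct (unit_circle_angle (A x0) (B x0)) as [phi [HcA HsB]].
  { transitivity ((c x0 ^ 2 + s x0 ^ 2) * (cos (tau * x0) ^ 2 + sin (tau * x0) ^ 2)).
    - unfold A, B; ring.
    - rewrite H1, Hcs by exact Hx0; ring. }
  exists phi; intros x Hx.
  (* The addition formulas rotate [(A, B)] forward by [tau * x], which gives back [(c, s)]. *)
  rewrite cos_plus, sin_plus, <- HcA, <- HsB, <- (HA x Hx), <- (HB x Hx).
  unfold A, B; split.
  - transitivity (c x * (cos (tau * x) ^ 2 + sin (tau * x) ^ 2)); [rewrite Hcs|]; ring.
  - transitivity (s x * (cos (tau * x) ^ 2 + sin (tau * x) ^ 2)); [rewrite Hcs|]; ring.
Qed.

(** * Galilean products of isotropic vectors *)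

Lemma gdot_isotropic (v w : R3) :
  c1 v = 0 -> c1 w = 0 -> gdot v w = c2 v * c2 w + c3 v * c3 w.
Proof.
  intros Hv Hw; unfold gdot.
  destruct (Req_EM_T (c1 v) 0), (Req_EM_T (c1 w) 0); tauto.
Qed.

Lemma gnorm_isotropic (v : R3) :
  c1 v = 0 -> gnorm v = sqrt (c2 v ^ 2 + c3 v ^ 2).
Proof.
  intros Hv; unfold gnorm; rewrite gdot_isotropic by exact Hv.
  f_equal; rewrite Rabs_pos_eq; nra.
Qed.

(** If both components vanished, [c1 w * v - c1 v * w] would be the zero vector, a linear relation
    that is nontrivial as soon as one of [v], [w] is not isotropic. *)
Lemma gcross_neq_0 (v w : R3) :
  lin_indep v w -> c1 v <> 0 \/ c1 w <> 0 ->
  0 < c2 (gcross v w) ^ 2 + c3 (gcross v w) ^ 2.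
Proof.
  intros Hind Hc.
  destruct (Req_dec (c2 (gcross v w)) 0) as [H2|H2];
    [destruct (Req_dec (c3 (gcross v w)) 0) as [H3|H3]|].
  - exfalso.
    unfold gcross, c2, c3 in H2, H3; simpl in H2, H3.
    destruct (Hind (c1 w) (- c1 v)) as [Hw Hv]; [|lra].
    unfold c1, c2, c3 in *; repeat f_equal; lra.
  - generalize (pow2_ge_0 (c2 (gcross v w))), (pow2_gt_0 _ H3); lra.
  - generalize (pow2_ge_0 (c3 (gcross v w))), (pow2_gt_0 _ H2); lra.
Qed.

(** * Continuity of pairs, partial derivatives and real operations *)

Lemma continuous_pair {T U V : UniformSpace} (f : T -> U) (g : T -> V) (x : T) :
  continuous f x -> continuous g x -> continuous (fun t => (f t, g t)) x.
Proof.
  intros Hf Hg; apply filterlim_locally; intros eps.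
  generalize (filter_and _ _ (proj1 (filterlim_locally f (f x)) Hf eps)
                             (proj1 (filterlim_locally g (g x)) Hg eps)).
  apply filter_imp; intros t [H1 H2]; split; assumption.
Qed.

Lemma smooth2_on_continuous_partial_u (U : R2 -> Prop) (f : R2 -> R) (q : R2) :
  smooth2_on U f -> U q ->
  continuous (fun p : R2 => Derive (fun s => f (s, snd p)) (fst p)) q.
Proof.
  destruct q as [u v]; intros Hf Hq.
  destruct (Hf 1%nat u v Hq) as (_ & _ & _ & [H _] & _).
  exact (proj1 (continuity_2d_pt_filterlim _ _ _) H).
Qed.

Lemma smooth2_on_continuous_partial_v (U : R2 -> Prop) (f : R2 -> R) (q : R2) :
  smooth2_on U f -> U q ->
  continuous (fun p : R2 => Derive (fun t => f (fst p, t)) (snd p)) q.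
Proof.
  destruct q as [u v]; intros Hf Hq.
  destruct (Hf 1%nat u v Hq) as (_ & _ & _ & _ & [H _]).
  exact (proj1 (continuity_2d_pt_filterlim _ _ _) H).
Qed.

(** This and the next two lemmas are phrased with the operations of [R] instead of the abstract
    algebraic ones, so that unification finds them in real expressions. *)
Lemma continuous_Rmult {T : UniformSpace} (f g : T -> R) (x : T) :
  continuous f x -> continuous g x -> continuous (fun t => f t * g t) x.
Proof. exact (continuous_mult f g x). Qed.

Lemma continuous_Rminus {T : UniformSpace} (f g : T -> R) (x : T) :
  continuous f x -> continuous g x -> continuous (fun t => f t - g t) x.
Proof. exact (continuous_minus f g x). Qed.

Lemma continuous_Rplus {T : UniformSpace} (f g : T -> R) (x : T) :
  continuous f x -> continuous g x -> continuous (fun t => f t + g t) x.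
Proof. exact (continuous_plus f g x). Qed.

(** * The unit normal in a chart and along a curve *)

Section ChartNormal.

Variables (M : R3 -> Prop) (U : R2 -> Prop) (phi : R2 -> R3).
Hypothesis Hphi : is_parametrization M U phi.

Let N (q : R2) : R3 := gcross (partial_u phi q) (partial_v phi q).

Lemma chart_cross_pos (q : R2) : U q -> 0 < c2 (N q) ^ 2 + c3 (N q) ^ 2.
Proof.
  intros Hq; destruct Hphi as (_ & _ & _ & Hind & Hiso).
  apply gcross_neq_0; auto.
Qed.

Lemma chart_cross_continuous (q : R2) :
  U q -> continuous (fun p => c2 (N p)) q /\ continuous (fun p => c3 (N p)) q.
Proof.
  intros Hq; destruct Hphi as (_ & (S1 & S2 & S3) & _).
  assert (U1 := smooth2_on_continuous_partial_u U _ q S1 Hq).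
  assert (U2 := smooth2_on_continuous_partial_u U _ q S2 Hq).
  assert (U3 := smooth2_on_continuous_partial_u U _ q S3 Hq).
  assert (V1 := smooth2_on_continuous_partial_v U _ q S1 Hq).
  assert (V2 := smooth2_on_continuous_partial_v U _ q S2 Hq).
  assert (V3 := smooth2_on_continuous_partial_v U _ q S3 Hq).
  split.
  - exact (continuous_Rminus _ _ q (continuous_Rmult _ _ q U3 V1) (continuous_Rmult _ _ q U1 V3)).
  - exact (continuous_Rminus _ _ q (continuous_Rmult _ _ q U1 V2) (continuous_Rmult _ _ q U2 V1)).
Qed.

Lemma chart_normal_unit (q : R2) :
  U q -> c1 (chart_normal phi q) = 0 /\
         c2 (chart_normal phi q) ^ 2 + c3 (chart_normal phi q) ^ 2 = 1.
Proof.
  intros Hq; split; [apply Rmult_0_r|].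
  assert (Hpos := chart_cross_pos q Hq).
  assert (Hn : gnorm (N q) = sqrt (c2 (N q) ^ 2 + c3 (N q) ^ 2))
    by (apply gnorm_isotropic; reflexivity).
  change ((/ gnorm (N q) * c2 (N q)) ^ 2 + (/ gnorm (N q) * c3 (N q)) ^ 2 = 1).
  assert (Hg : 0 < gnorm (N q)) by (rewrite Hn; apply sqrt_lt_R0, Hpos).
  assert (Hsq : gnorm (N q) ^ 2 = c2 (N q) ^ 2 + c3 (N q) ^ 2)
    by (rewrite Hn; apply pow2_sqrt; lra).
  transitivity (/ gnorm (N q) ^ 2 * (c2 (N q) ^ 2 + c3 (N q) ^ 2)).
  - field; lra.
  - rewrite <- Hsq; field; lra.
Qed.

Lemma chart_normal_continuous (q : R2) :
  U q -> continuous (fun p => c2 (chart_normal phi p)) q /\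
         continuous (fun p => c3 (chart_normal phi p)) q.
Proof.
  intros Hq.
  assert (Hpos := chart_cross_pos q Hq).
  destruct (chart_cross_continuous q Hq) as [H2 H3].
  assert (Hinv : continuous (fun p => / gnorm (N p)) q).
  { apply (continuous_ext (fun p => / sqrt (c2 (N p) * c2 (N p) + c3 (N p) * c3 (N p)))).
    { intros p; rewrite (gnorm_isotropic (N p)) by reflexivity.
      do 2 f_equal; ring. }
    apply (continuous_comp (fun p => sqrt (c2 (N p) * c2 (N p) + c3 (N p) * c3 (N p))) Rinv).
    - apply (continuous_comp (fun p => c2 (N p) * c2 (N p) + c3 (N p) * c3 (N p)) sqrt).
      + apply continuous_Rplus; apply continuous_Rmult; assumption.
      + apply continuous_sqrt.
    - apply continuous_Rinv, Rgt_not_eq, sqrt_lt_R0; nra. }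
  split; apply continuous_Rmult; assumption.
Qed.

End ChartNormal.

Lemma unit_normal_unit (M : oriented_surface) (p : R3) :
  carrier M p ->
  c1 (unit_normal M p) = 0 /\
  c2 (unit_normal M p) ^ 2 + c3 (unit_normal M p) ^ 2 = 1.
Proof.
  intros Hp.
  destruct (surface_charts M p Hp) as (U & phi & eps & Hphi & (q & Hq & <-) & Heps & Hn).
  destruct (chart_normal_unit _ _ _ Hphi q Hq) as [H1 H2].
  rewrite (Hn q Hq).
  change (eps * c1 (chart_normal phi q) = 0 /\
    (eps * c2 (chart_normal phi q)) ^ 2 + (eps * c3 (chart_normal phi q)) ^ 2 = 1).
  destruct Heps as [-> | ->]; split; lra.
Qed.

(** Near [x] the curve stays in the image of one chart, where the normal along it is the fixed
    multiple [eps] of [chart_normal phi] composed with the inverse chart [psi] and [beta]. *)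
Lemma unit_normal_continuous_along (M : oriented_surface) (beta : R -> R3) (x : R) :
  locally x (fun t => carrier M (beta t)) ->
  continuous beta x ->
  continuous (fun t => c2 (unit_normal M (beta t))) x /\
  continuous (fun t => c3 (unit_normal M (beta t))) x.
Proof.
  intros HM Hbeta.
  assert (Hp := locally_singleton _ _ HM); simpl in Hp.
  destruct (surface_charts M _ Hp) as (U & phi & eps & Hphi & (q & Hq & Hqx) & _ & Hn).
  destruct (proj1 (proj2 (proj2 Hphi))) as (V & psi & HV & Hleft & Hright).
  destruct (Hleft q Hq) as (_ & HVx & Hpsi).
  rewrite Hqx in HVx, Hpsi.
  destruct (Hright _ Hp HVx) as (_ & _ & Hlim).
  assert (Hcont : continuous (fun t => psi (beta t)) x).
  (* [psi] is continuous only relative to the surface; this suffices because the curve lies on the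
     surface near [x]. *)
  { apply (filterlim_comp _ _ _ beta psi _ (within (carrier M) (locally (beta x))));
      [|exact Hlim].
    intros P HP; change (locally x (fun t => P (beta t))).
    assert (HP' : locally x (fun t => carrier M (beta t) -> P (beta t))) by exact (Hbeta _ HP).
    generalize (filter_and _ _ HM HP').
    apply filter_imp; intros t [Ht HPt]; exact (HPt Ht). }
  assert (Hloc : locally x (fun t =>
            scale3 eps (chart_normal phi (psi (beta t))) = unit_normal M (beta t))).
  { assert (HV' : locally x (fun t => V (beta t))) by exact (Hbeta _ (HV _ HVx)).
    generalize (filter_and _ _ HM HV').
    apply filter_imp; intros t [Ht HVt].
    destruct (Hright _ Ht HVt) as (HU & Hid & _).
    rewrite <- (Hn _ HU), Hid; reflexivity. }
  destruct (chart_normal_continuous _ _ _ Hphi q Hq) as [H2 H3].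
  rewrite <- Hpsi in H2, H3.
  split.
  - apply (continuous_ext_loc _ (fun t => eps * c2 (chart_normal phi (psi (beta t))))).
    { revert Hloc; apply filter_imp; intros t <-; reflexivity. }
    apply continuous_Rmult; [apply continuous_const|].
    exact (continuous_comp (fun t => psi (beta t)) (fun p => c2 (chart_normal phi p)) x Hcont H2).
  - apply (continuous_ext_loc _ (fun t => eps * c3 (chart_normal phi (psi (beta t))))).
    { revert Hloc; apply filter_imp; intros t <-; reflexivity. }
    apply continuous_Rmult; [apply continuous_const|].
    exact (continuous_comp (fun t => psi (beta t)) (fun p => c3 (chart_normal phi p)) x Hcont H3).
Qed.

(** * The acceleration of a unit-speed curve *)

(** In polar form [(f, g) = k (cos theta, sin theta)] this is [(cos theta)' = - theta' sin theta],
    with angular velocity [theta' = (f g' - g f') / k ^ 2]. *)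
Lemma is_derive_unit_fst (f g : R -> R) (x f' g' : R) :
  is_derive f x f' -> is_derive g x g' -> 0 < f x ^ 2 + g x ^ 2 ->
  let k t := sqrt (f t ^ 2 + g t ^ 2) in
  is_derive (fun t => f t / k t) x (- ((f x * g' - g x * f') / k x ^ 2) * (g x / k x)).
Proof.
  intros Hf Hg Hpos k.
  assert (Hk : 0 < k x) by (apply sqrt_lt_R0, Hpos).
  assert (Hsq : k x ^ 2 = f x ^ 2 + g x ^ 2) by (apply pow2_sqrt; lra).
  assert (Hk' : is_derive k x ((f x * f' + g x * g') / k x)).
  { unfold k; auto_derive; [repeat split; try (eexists; eassumption); simpl in Hpos; lra|].
    replace (Derive (fun t => f t) x) with f' by (symmetry; exact (is_derive_unique f _ _ Hf)).
    replace (Derive (fun t => g t) x) with g' by (symmetry; exact (is_derive_unique g _ _ Hg)).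
    change (sqrt _) with (k x).
    field; lra. }
  evar_last; [apply is_derive_div; [exact Hf|exact Hk'|lra]|].
  transitivity ((f' * k x ^ 2 - f x * (f x * f' + g x * g')) / k x ^ 3).
  - field; lra.
  (* Expanding only the [k x ^ 2] in the numerator cancels [f x ^ 2 * f'] and leaves the factor
     [g x]. *)
  - rewrite Hsq at 1; field; lra.
Qed.

Section UnitSpeedCurve.

Variables (a b : Rbar) (beta : R -> R3).
Let I := Rbar_open_interval a b.
Hypothesis Hbeta : unit_speed_curve I beta.

(** [y2] and [z2] are convertible to the isotropic components of [vderive (vderive beta)]; the
    [Derive_n] form matches the smoothness hypothesis. *)
Let y2 (t : R) : R := Derive_n (fun s => c2 (beta s)) 2 t.
Let z2 (t : R) : R := Derive_n (fun s => c3 (beta s)) 2 t.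

(** The equation [c1 (beta t) = t] holds on the open set [I], hence near each of its points, and may
    be differentiated there. The next two lemmas repeat the argument. *)
Lemma unit_speed_velocity_c1 (x : R) : I x -> c1 (vderive beta x) = 1.
Proof.
  intros Hx; transitivity (Derive (fun t => t) x); [|apply Derive_id].
  apply Derive_ext_loc; generalize (Rbar_open_interval_locally a b x Hx).
  apply filter_imp; exact (proj2 Hbeta).
Qed.

Lemma unit_speed_acceleration_c1 (x : R) : I x -> c1 (vderive (vderive beta) x) = 0.
Proof.
  intros Hx; transitivity (Derive (fun _ => 1) x); [|apply Derive_const].
  apply Derive_ext_loc; generalize (Rbar_open_interval_locally a b x Hx).
  apply filter_imp; exact unit_speed_velocity_c1.
Qed.

Lemma unit_speed_jerk_c1 (x : R) : I x -> c1 (vderive (vderive (vderive beta)) x) = 0.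
Proof.
  intros Hx; transitivity (Derive (fun _ => 0) x); [|apply Derive_const].
  apply Derive_ext_loc; generalize (Rbar_open_interval_locally a b x Hx).
  apply filter_imp; exact unit_speed_acceleration_c1.
Qed.

Lemma unit_speed_is_derive (n : nat) (x : R) : I x ->
  is_derive (Derive_n (fun s => c2 (beta s)) n) x (Derive_n (fun s => c2 (beta s)) (S n) x) /\
  is_derive (Derive_n (fun s => c3 (beta s)) n) x (Derive_n (fun s => c3 (beta s)) (S n) x).
Proof.
  intros Hx; destruct Hbeta as ((_ & H2 & H3) & _).
  (* Existence of the derivative of order [S n] is by definition differentiability of the [n]-th
     one. *)
  split; apply Derive_correct; [exact (H2 (S n) x Hx)|exact (H3 (S n) x Hx)].
Qed.

Lemma unit_speed_continuous (x : R) : I x -> continuous beta x.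
Proof.
  intros Hx; destruct Hbeta as ((H1 & H2 & H3) & _).
  apply (continuous_ext (fun t => (c1 (beta t), c2 (beta t), c3 (beta t)))).
  { intros t; destruct (beta t) as [[u v] w]; reflexivity. }
  apply (continuous_pair (fun t => (c1 (beta t), c2 (beta t)))); [apply continuous_pair|].
  - exact (ex_derive_continuous (fun t => c1 (beta t)) x (H1 1%nat x Hx)).
  - exact (ex_derive_continuous (fun t => c2 (beta t)) x (H2 1%nat x Hx)).
  - exact (ex_derive_continuous (fun t => c3 (beta t)) x (H3 1%nat x Hx)).
Qed.

Lemma unit_speed_curvature (x : R) :
  I x -> curvature beta x = sqrt (y2 x ^ 2 + z2 x ^ 2).
Proof. intros Hx; apply gnorm_isotropic, unit_speed_acceleration_c1, Hx. Qed.

(** The first components of velocity, acceleration and jerk are 1, 0, 0, so the determinant reduces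
    to a single 2 by 2 minor. *)
Lemma unit_speed_torsion (x : R) :
  I x -> torsion beta x =
    (y2 x * Derive_n (fun s => c3 (beta s)) 3 x - z2 x * Derive_n (fun s => c2 (beta s)) 3 x)
    / curvature beta x ^ 2.
Proof.
  intros Hx; unfold torsion, det3.
  rewrite unit_speed_velocity_c1, unit_speed_acceleration_c1, unit_speed_jerk_c1 by exact Hx.
  f_equal; change (c2 (vderive (vderive beta) x)) with (y2 x).
  change (c3 (vderive (vderive beta) x)) with (z2 x).
  change (c2 (vderive (vderive (vderive beta)) x)) with (Derive_n (fun s => c2 (beta s)) 3 x).
  change (c3 (vderive (vderive (vderive beta)) x)) with (Derive_n (fun s => c3 (beta s)) 3 x).
  ring.
Qed.

(** The torsion is exactly the angular velocity of the normalized acceleration [(y2, z2) / k], which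
    therefore turns uniformly. *)
Lemma unit_speed_acceleration_angle (tau : R) :
  Rbar_lt a b ->
  (forall x, I x -> 0 < curvature beta x) ->
  (forall x, I x -> torsion beta x = tau) ->
  exists phi, forall x, I x ->
    y2 x = curvature beta x * cos (tau * x + phi) /\
    z2 x = curvature beta x * sin (tau * x + phi).
Proof.
  intros Hab Hk Htau.
  set (k t := sqrt (y2 t ^ 2 + z2 t ^ 2)).
  assert (Hkpos : forall x, I x -> 0 < k x).
  { intros x Hx; unfold k; rewrite <- unit_speed_curvature by exact Hx; auto. }
  assert (Hpos : forall x, I x -> 0 < y2 x ^ 2 + z2 x ^ 2).
  { intros x Hx; apply sqrt_lt_0_alt; rewrite sqrt_0; exact (Hkpos x Hx). }
  destruct (uniformly_rotating_unit_vector a b tau (fun t => y2 t / k t) (fun t => z2 t / k t))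
    as [phi Hphi]; [exact Hab| | | |].
  - intros x Hx; destruct (unit_speed_is_derive 2 x Hx) as [Hy Hz].
    rewrite <- (Htau x Hx), unit_speed_torsion, unit_speed_curvature by exact Hx.
    exact (is_derive_unit_fst y2 z2 x _ _ Hy Hz (Hpos x Hx)).
  - intros x Hx; destruct (unit_speed_is_derive 2 x Hx) as [Hy Hz].
    (* The second component follows from the same derivative formula with [y2] and [z2] exchanged;
       the exchange reverses the angular velocity and so produces the sign [+ tau]. *)
    apply (is_derive_ext (fun t => z2 t / sqrt (z2 t ^ 2 + y2 t ^ 2))).
    { intros t; unfold k; rewrite Rplus_comm; reflexivity. }
    evar_last.
    { apply (is_derive_unit_fst z2 y2 x _ _ Hz Hy); rewrite Rplus_comm; exact (Hpos x Hx). }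
    cbv beta zeta; rewrite (Rplus_comm (z2 x ^ 2)).
    rewrite <- (Htau x Hx), unit_speed_torsion, unit_speed_curvature by exact Hx.
    unfold k; field; apply Rgt_not_eq, (Hkpos x Hx).
  - intros x Hx; specialize (Hkpos x Hx).
    assert (Hsq : k x ^ 2 = y2 x ^ 2 + z2 x ^ 2)
      by (apply pow2_sqrt, Rlt_le, Hpos, Hx).
    transitivity ((y2 x ^ 2 + z2 x ^ 2) / k x ^ 2); [field; lra|].
    rewrite <- Hsq; field; lra.
  - exists phi; intros x Hx; rewrite unit_speed_curvature by exact Hx.
    destruct (Hphi x Hx) as [<- <-]; specialize (Hkpos x Hx).
    fold (k x); split; field; lra.
Qed.

(** For a geodesic the acceleration is parallel to [n], so [kappa_n / kappa] is
    a continuous function with values in [{1, -1}]. *)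
Lemma geodesic_normal_curvature (M : oriented_surface) :
  Rbar_lt a b ->
  (forall x, I x -> carrier M (beta x)) ->
  (forall x, I x -> 0 < curvature beta x) ->
  is_geodesic I M beta ->
  exists eps, (eps = 1 \/ eps = -1) /\
    forall x, I x -> normal_curvature M beta x = eps * curvature beta x.
Proof.
  intros Hab HM Hk Hgeo.
  set (n2 t := c2 (unit_normal M (beta t))).
  set (n3 t := c3 (unit_normal M (beta t))).
  set (s t := (y2 t * n2 t + z2 t * n3 t) / sqrt (y2 t ^ 2 + z2 t ^ 2)).
  assert (Hn1 : forall x, I x -> c1 (unit_normal M (beta x)) = 0).
  { intros x Hx; apply unit_normal_unit, HM, Hx. }
  assert (Hkn : forall x, I x -> normal_curvature M beta x = y2 x * n2 x + z2 x * n3 x).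
  { intros x Hx; apply gdot_isotropic; [apply unit_speed_acceleration_c1, Hx|exact (Hn1 x Hx)]. }
  (* Since [T] has first component 1 and [n] is isotropic, [Q = (0, - n3, n2)]; vanishing geodesic
     curvature says that acceleration and normal are parallel. *)
  assert (Hkg : forall x, I x -> z2 x * n2 x - y2 x * n3 x = 0).
  { intros x Hx; rewrite <- (Hgeo x Hx); unfold geodesic_curvature.
    rewrite gdot_isotropic; [|exact (unit_speed_acceleration_c1 x Hx)|reflexivity].
    change (c2 (darboux_Q M beta x)) with
      (c3 (vderive beta x) * c1 (unit_normal M (beta x)) - c1 (vderive beta x) * n3 x).
    change (c3 (darboux_Q M beta x)) with
      (c1 (vderive beta x) * n2 x - c2 (vderive beta x) * c1 (unit_normal M (beta x))).
    change (c2 (vderive (darboux_T beta) x)) with (y2 x).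
    change (c3 (vderive (darboux_T beta) x)) with (z2 x).
    rewrite unit_speed_velocity_c1, Hn1 by exact Hx; ring. }
  assert (Hsk : forall x, I x -> normal_curvature M beta x = s x * curvature beta x).
  { intros x Hx; assert (Hkx := Hk x Hx).
    rewrite Hkn by exact Hx; rewrite unit_speed_curvature in * by exact Hx.
    unfold s; field; lra. }
  assert (Hs : forall x, I x -> s x = 1 \/ s x = -1).
  { intros x Hx; assert (Hkx := Hk x Hx).
    assert (Hsq : curvature beta x ^ 2 = y2 x ^ 2 + z2 x ^ 2).
    { rewrite unit_speed_curvature by exact Hx; apply pow2_sqrt.
      generalize (pow2_ge_0 (y2 x)), (pow2_ge_0 (z2 x)); lra. }
    assert (Hn : n2 x ^ 2 + n3 x ^ 2 = 1) by (apply unit_normal_unit, HM, Hx).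
    assert (Hsk2 : (s x * curvature beta x) ^ 2 = curvature beta x ^ 2).
    { rewrite <- Hsk, Hkn by exact Hx.
      (* Lagrange's identity in the plane: the subtracted square is that of the geodesic
         curvature. *)
      transitivity ((y2 x ^ 2 + z2 x ^ 2) * (n2 x ^ 2 + n3 x ^ 2)
                    - (z2 x * n2 x - y2 x * n3 x) ^ 2); [ring|].
      rewrite Hn, Hkg, Hsq by exact Hx; ring. }
    assert (H0 : (s x - 1) * (s x + 1) = 0).
    { apply (Rmult_eq_reg_r (curvature beta x ^ 2)); nra. }
    destruct (Rmult_integral _ _ H0); [left|right]; lra. }
  assert (Hc : forall x, I x -> continuous s x).
  { intros x Hx.
    destruct (unit_speed_is_derive 2 x Hx) as [Hy Hz].
    assert (Hcy : continuous y2 x) by exact (ex_derive_continuous y2 x (ex_intro _ _ Hy)).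
    assert (Hcz : continuous z2 x) by exact (ex_derive_continuous z2 x (ex_intro _ _ Hz)).
    destruct (unit_normal_continuous_along M beta x) as [Hc2 Hc3].
    - generalize (Rbar_open_interval_locally a b x Hx); apply filter_imp, HM.
    - exact (unit_speed_continuous x Hx).
    - assert (Hkx := Hk x Hx); rewrite unit_speed_curvature in Hkx by exact Hx.
      apply continuous_Rmult.
      + apply continuous_Rplus; apply continuous_Rmult; assumption.
      + apply continuous_Rinv_comp; [|lra].
        apply continuous_sqrt_comp, continuous_Rplus;
          (* A square unfolds to [u * (u * 1)], hence two products and a constant factor 1. *)
          (apply (continuous_Rmult _ _ x); [|apply (continuous_Rmult _ (fun _ => 1) x)]);
          first [assumption|apply continuous_const]. }
  destruct (Rbar_open_interval_inhabited a b Hab) as [x0 Hx0].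
  exists (s x0); split; [exact (Hs x0 Hx0)|].
  intros x Hx; rewrite (Hsk x Hx); f_equal.
  exact (continuous_sign_constant a b s Hc Hs x x0 Hx Hx0).
Qed.

End UnitSpeedCurve.

(** * Recovering the curve from its acceleration *)

Theorem corollary4p6 (a b0 : Rbar) (hI : Rbar_lt a b0)
  (M : oriented_surface) (beta : R -> R3)
  (hbeta : unit_speed_curve (Rbar_open_interval a b0) beta)
  (hM : forall x : R, Rbar_open_interval a b0 x -> carrier M (beta x))
  (hkappa : forall x : R, Rbar_open_interval a b0 x -> 0 < curvature beta x)
  (hgeo : is_geodesic (Rbar_open_interval a b0) M beta)
  (hanti : anti_salkowski (Rbar_open_interval a b0) beta) :
  exists b b1 b2 b3 : R, exists Y Z : R -> R,
    double_antiderivative_on (Rbar_open_interval a b0) Y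
      (fun x => normal_curvature M beta x * (cos (b * x + b1) + b2)) /\
    double_antiderivative_on (Rbar_open_interval a b0) Z
      (fun x => normal_curvature M beta x * (sin (b * x + b1) + b3)) /\
    forall x : R, Rbar_open_interval a b0 x -> beta x = (x, Y x, - Z x).
Proof.
  destruct hanti as [[tau Htau] _].
  destruct (unit_speed_acceleration_angle a b0 beta hbeta tau hI hkappa Htau) as [phi Hphi].
  destruct (geodesic_normal_curvature a b0 beta hbeta M hI hM hkappa hgeo)
    as (eps & Heps & Hkn).
  (* The minus sign before the third coordinate calls for the reflected angle [- (tau * x + phi)],
     whence the frequency [- tau]; when [eps = -1], a further shift by [PI] changes the sign of both
     cosine and sine. *)
  assert (Hb1 : exists b1, forall x,
            cos (- tau * x + b1) = eps * cos (tau * x + phi) /\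
            sin (- tau * x + b1) = - (eps * sin (tau * x + phi))).
  { destruct Heps as [-> | ->].
    - exists (- phi); intros x.
      replace (- tau * x + - phi) with (- (tau * x + phi)) by ring.
      rewrite cos_neg, sin_neg; lra.
    - exists (- phi + PI); intros x.
      replace (- tau * x + (- phi + PI)) with (- (tau * x + phi) + PI) by ring.
      rewrite neg_cos, neg_sin, cos_neg, sin_neg; lra. }
  destruct Hb1 as [b1 Hb1].
  assert (Heps2 : eps * eps = 1) by (destruct Heps as [-> | ->]; lra).
  (* The coordinates of [beta] serve as the double antiderivatives, the integration constants being
     thereby fixed; their first derivatives are the intermediate ones. *)
  exists (- tau), b1, 0, 0, (fun x => c2 (beta x)), (fun x => - c3 (beta x)).
  split; [|split].
  - exists (Derive (fun t => c2 (beta t))).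
    split; intros x Hx; [|exact (proj1 (unit_speed_is_derive a b0 beta hbeta 0 x Hx))].
    evar_last; [exact (proj1 (unit_speed_is_derive a b0 beta hbeta 1 x Hx))|].
    rewrite (proj1 (Hphi x Hx)), (Hkn x Hx), (proj1 (Hb1 x)).
    (* One factor [eps] comes from the normal curvature and one from the phase; they cancel. *)
    transitivity (eps * eps * (curvature beta x * cos (tau * x + phi))); [rewrite Heps2|]; ring.
  - exists (fun x => - Derive (fun t => c3 (beta t)) x).
    split; intros x Hx;
      [|exact (is_derive_opp _ _ _ (proj2 (unit_speed_is_derive a b0 beta hbeta 0 x Hx)))].
    evar_last;
      [exact (is_derive_opp _ _ _ (proj2 (unit_speed_is_derive a b0 beta hbeta 1 x Hx)))|].
    rewrite (proj2 (Hphi x Hx)), (Hkn x Hx), (proj2 (Hb1 x)).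
    change (opp ?u) with (- u).
    transitivity (- (eps * eps * (curvature beta x * sin (tau * x + phi)))); [rewrite Heps2|]; ring.
  - intros x Hx; generalize (proj2 hbeta x Hx).
    destruct (beta x) as [[u v] w]; unfold c1, c2, c3; simpl.
    intros ->; rewrite Ropp_involutive; reflexivity.
Qed.
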